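(* Let $\alpha\in(0,1)$ and let $\Omega\subset\mathbb{R}^n$ be an open set. If $(f_\beta)_{\beta\in(0,\alpha)}\subset L^1(\mathbb{R}^n)$ satisfies $f_\beta\to f$ in $L^1(\mathbb{R}^n)$ as $\beta\to\alpha^-$, then $$|D^\alpha f|(\Omega)\le\liminf_{\beta\to\alpha^-}|D^\beta f_\beta|(\Omega).$$
   Context: Here $n\in\mathbb{N}$, $n\ge1$. For $\alpha\in(0,1)$ let $\mu_{n,\alpha}:=2^\alpha\pi^{-n/2}\,\Gamma\big(\tfrac{n+\alpha+1}{2}\big)/\Gamma\big(\tfrac{1-\alpha}{2}\big)$, and for $\varphi\in C^\infty_c(\mathbb{R}^n;\mathbb{R}^n)$ let $$\mathrm{div}^\alpha\varphi(x):=\mu_{n,\alpha}\int_{\mathbb{R}^n}\frac{(y-x)\cdot(\varphi(y)-\varphi(x))}{|y-x|^{n+\alpha+1}}\,dy,\qquad x\in\mathbb{R}^n,$$ which belongs to $L^1(\mathbb{R}^n)\cap L^\infty(\mathbb{R}^n)$. For $g\in L^1(\mathbb{R}^n)$ and $\Omega\subset\mathbb{R}^n$ open, $$|D^\alpha g|(\Omega):=\sup\Big\{\int_{\mathbb{R}^n} g\,\mathrm{div}^\alpha\varphi\,dx:\ \varphi\in C^\infty_c(\Omega;\mathbb{R}^n),\ \|\varphi\|_{L^\infty(\Omega;\mathbb{R}^n)}\le1\Big\}\in[0,+\infty].$$ *)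

(* Defs.v *)
From HB Require Import structures.
From mathcomp Require Import all_boot all_order all_algebra.
From mathcomp Require Import all_classical all_reals all_analysis.

Set Implicit Arguments.
Unset Strict Implicit.
Unset Printing Implicit Defensive.

Import Order.TTheory GRing.Theory Num.Theory.
Import numFieldNormedType.Exports.

Local Open Scope classical_set_scope.
Local Open Scope ring_scope.

(* R^n is 'rV[R]_n. The library has no measurable structure on it: it gets the
   product sigma-algebra of the Borel sigma-algebra of R (the Borel
   sigma-algebra of R^n), defined as the library does for n.-tuple T. *)
Definition rV_display : measure_display.
Proof. exact: default_measure_display. Qed.

Definition rV_coord (R : realType) n (i : 'I_n) (v : 'rV[R]_n) :
  measurableTypeR R := v ord0 i.

HB.instance Definition _ (R : realType) n :=
  @isMeasurable.Build rV_display 'rV[R]_n (g_sigma_preimage (@rV_coord R n))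
    (@sigma_algebra0 _ setT _) (@sigma_algebraC _ _)
    (@sigma_algebra_bigcup _ _ _).

Lemma measurable_rV_coord (R : realType) n (i : 'I_n) :
  measurable_fun [set: 'rV[R]_n] (rV_coord i).
Proof.
move=> _ Y mY; rewrite setTI; apply: sub_sigma_algebra => /=.
rewrite -bigcup_seq/=; exists i => /=; first by rewrite mem_index_enum.
by exists Y => //; rewrite setTI.
Qed.

Lemma measurable_fun_rV (R : realType) n d (T : measurableType d)
    (f : T -> 'rV[R]_n) :
  (forall i, measurable_fun [set: T] (rV_coord i \o f)) ->
  measurable_fun [set: T] f.
Proof.
move=> mf.
have sub : g_sigma_preimage (fun i => @rV_coord R n i \o f) `<=` measurable.
  apply: smallest_sub; first exact: sigma_algebra_measurable.
  case: n => [|n] in f mf *; first by rewrite big_ord0.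
  rewrite -bigcup_mkord_ord; apply: bigcup_sub => i Ii.
  by move=> A [B mB <-]; exact: mf.
move=> _ A mA; apply: sub; rewrite g_sigma_preimage_comp.
by exists A.
Qed.

Definition rV_cons (R : realType) n (p : measurableTypeR R * 'rV[R]_n) :
    'rV[R]_n.+1 :=
  \row_i (if unlift ord0 i is Some j then p.2 ord0 j else p.1).

Definition rV_uncons (R : realType) n (v : 'rV[R]_n.+1) :
    measurableTypeR R * 'rV[R]_n :=
  (v ord0 ord0, \row_j v ord0 (lift ord0 j)).

Lemma rV_consK (R : realType) n : cancel (@rV_cons R n) (@rV_uncons R n).
Proof.
move=> [x v]; rewrite /rV_uncons /rV_cons mxE unlift_none; congr (_, _).
by apply/rowP => j; rewrite !mxE liftK.
Qed.

Lemma measurable_rV_cons (R : realType) n :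
  measurable_fun [set: measurableTypeR R * 'rV[R]_n] (@rV_cons R n).
Proof.
apply: measurable_fun_rV => i; case: (unliftP ord0 i) => [j|] ->.
  rewrite (_ : _ \o _ = rV_coord j \o snd).
    by apply: measurableT_comp => //; exact: measurable_rV_coord.
  by apply/funext => -[x v]; rewrite /rV_coord /= mxE liftK.
rewrite (_ : _ \o _ = fst) //.
by apply/funext => -[x v]; rewrite /rV_coord /= mxE unlift_none.
Qed.

Lemma measurable_rV_uncons (R : realType) n :
  measurable_fun [set: 'rV[R]_n.+1] (@rV_uncons R n).
Proof.
apply/measurable_fun_pairP; split; first exact: measurable_rV_coord.
apply: measurable_fun_rV => j.
rewrite (_ : _ \o _ = rV_coord (lift ord0 j)); first exact: measurable_rV_coord.
by apply/funext => v; rewrite /rV_coord /= mxE.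
Qed.

Section lebesgue_rV_step.
Context (R : realType) (n : nat).
Variable mu : {sigma_finite_measure set 'rV[R]_n -> \bar R}.
Local Open Scope ereal_scope.

Definition lebesgue_rV_step : set 'rV[R]_n.+1 -> \bar R :=
  pushforward (@lebesgue_measure R \x mu) (@rV_cons R n).

Let step0 : lebesgue_rV_step set0 = 0.
Proof. by rewrite /lebesgue_rV_step /pushforward preimage_set0 measure0. Qed.

Let step_ge0 A : 0 <= lebesgue_rV_step A.
Proof. by rewrite /lebesgue_rV_step /pushforward measure_ge0. Qed.

Let step_sigma_additive : semi_sigma_additive lebesgue_rV_step.
Proof.
move=> F mF tF mUF; rewrite /lebesgue_rV_step /pushforward preimage_bigcup.
have mcons (A : set 'rV[R]_n.+1) : measurable A ->
    measurable (@rV_cons R n @^-1` A).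
  by rewrite -[X in _ -> measurable X]setTI; exact: measurable_rV_cons.
apply: measure_semi_sigma_additive.
- by move=> k; exact: mcons.
- apply/trivIsetP => /= i j _ _ ij; rewrite -preimage_setI.
  by move/trivIsetP : tF => /(_ _ _ _ _ ij) ->//; rewrite preimage_set0.
- by rewrite -preimage_bigcup; exact: mcons.
Qed.

HB.instance Definition _ := isMeasure.Build _ _ _ lebesgue_rV_step
  step0 step_ge0 step_sigma_additive.

Let step_sigma_finite : sigma_finite setT lebesgue_rV_step.
Proof.
have /sigma_finiteP[F [TF ndF Foo]] := sigma_finiteT (@lebesgue_measure R).
have /sigma_finiteP[G [TG ndG Goo]] := sigma_finiteT mu.
exists (fun k => @rV_uncons R n @^-1` (F k `*` G k)).
  rewrite -preimage_bigcup (_ : \bigcup_k _ = setT) ?preimage_setT//.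
  rewrite -setXTT TF TG predeqE => -[x y]; split.
    by move=> [k _ [/= ? ?]]; split; exists k.
  move=> [/= [k _ Fkx] [l _ Gly]]; exists (maxn k l) => //; split.
  - by move: x Fkx; exact/subsetPset/ndF/leq_maxl.
  - by move: y Gly; exact/subsetPset/ndG/leq_maxr.
move=> k; have [mF Fk] := Foo k; have [mG Gk] := Goo k; split.
  rewrite -[X in measurable X]setTI; apply: measurable_rV_uncons => //.
  exact: measurableX.
rewrite /lebesgue_rV_step /pushforward -comp_preimage.
rewrite (_ : _ \o _ = id) ?preimage_id; last first.
  by apply/funext => p /=; rewrite rV_consK.
by rewrite product_measure1E// lte_mul_pinfty// ge0_fin_numE.
Qed.

HB.instance Definition _ := Measure_isSigmaFinite.Build _ _ _ lebesgue_rV_step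
  step_sigma_finite.

End lebesgue_rV_step.

(* n-dimensional Lebesgue measure, i.e. the n-fold product of lebesgue_measure
   (the unit mass on the one-point space R^0). *)
Fixpoint lebesgue_rV (R : realType) n :
    {sigma_finite_measure set 'rV[R]_n -> \bar R} :=
  if n is n'.+1 then lebesgue_rV_step (lebesgue_rV R n') else \d_(0 : 'rV[R]_0).

(* The norm `|x| of 'rV[R]_n is the sup norm, hence these. *)
Definition dotv (R : realType) n (x y : 'rV[R]_n) : R :=
  \sum_i x ord0 i * y ord0 i.

Definition enorm (R : realType) n (x : 'rV[R]_n) : R := Num.sqrt (dotv x x).

Fixpoint class_C (R : realType) n (W : normedModType R) (k : nat)
    (g : 'rV[R]_n -> W) : Prop :=
  if k is k'.+1 then
    continuous g /\
    forall i : 'I_n, (forall x, derivable g x (delta_mx ord0 i)) /\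
                     class_C k' ('D_(delta_mx ord0 i) g)
  else continuous g.

(* Test fields on Omega are extended by 0 to the whole of R^n. *)
Definition Cc_infty (R : realType) n (W : normedModType R)
    (Omega : set 'rV[R]_n) (phi : 'rV[R]_n -> W) : Prop :=
  [/\ forall k, class_C k phi,
      compact (closure [set x | phi x != 0])
    & closure [set x | phi x != 0] `<=` Omega].

Definition Gamma (R : realType) (s : R) : R :=
  \int[@lebesgue_measure R]_(t in `]0, +oo[) (t `^ (s - 1) * expR (- t)).

Definition mu_frac (R : realType) (n : nat) (alpha : R) : R :=
  2 `^ alpha * pi `^ (- (n%:R / 2)) *
  Gamma ((n%:R + alpha + 1) / 2) / Gamma ((1 - alpha) / 2).

Definition fdiv (R : realType) n (alpha : R) (phi : 'rV[R]_n -> 'rV[R]_n)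
    (x : 'rV[R]_n) : R :=
  mu_frac n alpha *
  \int[lebesgue_rV R n]_y
    (dotv (y - x) (phi y - phi x) / enorm (y - x) `^ (n%:R + alpha + 1)).

(* The norm of L^oo(Omega; R^n): `f \_ Omega` is f extended by 0 outside Omega,
   which does not change the essential supremum of a nonnegative function. *)
Definition Linfty_norm (R : realType) n (Omega : set 'rV[R]_n)
    (phi : 'rV[R]_n -> 'rV[R]_n) : \bar R :=
  'N[lebesgue_rV R n]_+oo%E[EFin \o ((fun x => enorm (phi x)) \_ Omega)].

Definition frac_variation (R : realType) n (alpha : R) (g : 'rV[R]_n -> R)
    (Omega : set 'rV[R]_n) : \bar R :=
  ereal_sup [set (\int[lebesgue_rV R n]_x (g x * fdiv alpha phi x)%:E)%E |
             phi in [set phi | Cc_infty Omega phi /\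
                               (Linfty_norm Omega phi <= 1)%E]].

(* Main.v *)
(* Fix a test field phi. As phi is bounded and Lipschitz, for all beta in
   [alpha/2, alpha] the integrand of fdiv beta phi x is dominated by a multiple
   of |y - x|^(-(n-1+alpha)) near x and of |y - x|^(-(n+alpha/2)) far from x,
   whose integral is finite and independent of x. Hence, as beta tends to alpha
   from the left, fdiv beta phi stays uniformly bounded and converges pointwise
   to fdiv alpha phi (mu_frac is continuous because Gamma is). Dominated
   convergence against f and the L^1 convergence of f_beta then show that the
   integral of f_beta * fdiv beta phi converges to that of f * fdiv alpha phi.
   Each of the former is at most |D^beta f_beta|(Omega), so the limit is below
   the lower limit; take the supremum over phi. *)

Require Import Defs.
From mathcomp Require Import all_boot all_order all_algebra.
From mathcomp Require Import all_classical all_reals all_analysis.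
From mathcomp Require Import measurable_realfun ring lra.

Set Implicit Arguments.
Unset Strict Implicit.
Unset Printing Implicit Defensive.

Import Order.TTheory GRing.Theory Num.Theory.
Import numFieldNormedType.Exports.

Local Open Scope classical_set_scope.
Local Open Scope ring_scope.

(** * Borel measurability on R^n and the volume of sup-norm balls *)

Lemma rV_normP (R : realType) n (x : 'rV[R]_n) (e : R) : 0 <= e ->
  reflect (forall i, `|x ord0 i| <= e) (`|x| <= e).
Proof.
move=> e0; rewrite [X in X <= _]/Num.Def.normr/= mx_normrE.
apply: (iffP idP) => [xe i|xe].
  by apply: le_trans xe;
  exact: (le_bigmax _ (fun i : 'I_1 * 'I_n => `|x i.1 i.2|) (ord0, i)).
by apply: bigmax_le => // -[i j] _ /=; rewrite ord1.
Qed.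

Lemma coord_le_norm (R : realType) n (x : 'rV[R]_n) i : `|x ord0 i| <= `|x|.
Proof. exact: (rV_normP x (normr_ge0 _)). Qed.

Lemma sup_ballE (R : realType) n (x : 'rV[R]_n) (r : R) : 0 <= r ->
  [set y | `|y - x| <= r] =
  \bigcap_(i in [set: 'I_n]) [set y | `|rV_coord i y - x ord0 i| <= r].
Proof.
move=> r0; apply/seteqP; split=> [y /= /(rV_normP _ r0) yx i _ /=|y yx /=].
  by have := yx i; rewrite !mxE.
by apply/rV_normP => // i; have /= := yx i I; rewrite !mxE.
Qed.

Lemma measurable_sup_ball (R : realType) n (x : 'rV[R]_n) (r : R) :
  0 <= r -> measurable [set y : 'rV[R]_n | `|y - x| <= r].
Proof.
move=> r0; rewrite sup_ballE//; apply: fin_bigcap_measurable => // i _.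
rewrite -[X in measurable X]setTI.
rewrite (_ : [set y | _] =
    rV_coord i @^-1` `[x ord0 i - r, x ord0 i + r]).
  by apply: measurable_rV_coord.
by apply/seteqP; split => y /=; rewrite in_itv/= ler_distl.
Qed.

(** The sigma-algebra is generated by the coordinates, and a closed sup-norm ball is a finite
    intersection of coordinate slabs. An open set is the union of the countably many such balls it
    contains that have a rational centre and a radius 1/(k+1). *)
Lemma open_measurable_rV (R : realType) n (U : set 'rV[R]_n) :
  open U -> measurable U.
Proof.
move=> oU.
pose B (p : 'rV[rat]_n * nat) :=
  [set y : 'rV[R]_n | `|y - map_mx ratr p.1| <= p.2.+1%:R^-1].
pose I := [set p | B p `<=` U].
suff -> : U = \bigcup_(p in I) B p.
  rewrite bigcup_mkcond; apply: countable_bigcupT_measurable => [//|p].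
  by case: ifPn => // _; apply: measurable_sup_ball.
apply/seteqP; split=> [x Ux|x [p]]; last exact.
have /nbhs_ballP[e /= e0 xe] : nbhs x U by exact: open_nbhs_nbhs.
(* Half of [e]: the rational centre lies within 1/(k+1) of [x], and the ball around it has that same
   radius. *)
have [k ke] : exists k : nat, k.+1%:R^-1 < e / 2.
  have [k _ /(_ _ (leqnn _)) /= ke] :=
    near_infty_natSinv_lt (PosNum (divr_gt0 e0 (ltr0n R 2))).
  by exists k.
have kp : 0 < k.+1%:R^-1 :> R by [].
have /choice[q qx] : forall i : 'I_n,
    exists q : rat, `|x ord0 i - ratr q| <= k.+1%:R^-1.
  move=> i; have [z [xz [q _ qz]]] := @dense_rat R (ball (x ord0 i) k.+1%:R^-1)
     (ex_intro _ (x ord0 i) (ballxx (x ord0 i) kp)) (ball_open (x ord0 i) k.+1%:R^-1).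
  by exists q; rewrite qz; apply: ltW.
have xB : `|x - map_mx ratr (\row_i q i)| <= k.+1%:R^-1.
  by apply/rV_normP => // i; rewrite !mxE.
exists (\row_i q i, k) => // y /= yB; apply: xe; rewrite -ball_normE /=.
rewrite -(subrKA (map_mx ratr (\row_i q i))) (le_lt_trans (ler_normD _ _))//.
rewrite (splitr e) ltrD//; first exact: le_lt_trans xB ke.
by rewrite distrC; exact: le_lt_trans yB ke.
Qed.

Lemma continuous_measurable_rV (R : realType) n (g : 'rV[R]_n -> R) :
  continuous g -> measurable_fun [set: 'rV[R]_n] g.
Proof.
move=> /continuousP cg.
apply: (measurability _ (RGenOInfty.measurableE R)).
move=> _ [_ [a ->] <-]; rewrite setTI.
by apply: open_measurable_rV; apply: cg; exact: interval_open.
Qed.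

Lemma measurable_norm_rV (R : realType) n :
  measurable_fun [set: 'rV[R]_n] (fun x : 'rV[R]_n => `|x|).
Proof. by apply: continuous_measurable_rV; exact: norm_continuous. Qed.

Lemma continuous_measurable_rV2 (R : realType) n m
    (g : 'rV[R]_n -> 'rV[R]_m) :
  continuous g -> measurable_fun [set: 'rV[R]_n] g.
Proof.
move=> cg; apply: measurable_fun_rV => i; apply: continuous_measurable_rV => x.
by apply: continuous_comp; [exact: cg|exact: coord_continuous].
Qed.

Lemma measurable_coord (R : realType) n d (T : measurableType d)
    (f : T -> 'rV[R]_n) i :
  measurable_fun [set: T] f -> measurable_fun [set: T] (fun t => f t ord0 i : R).
Proof. by move=> mf; apply: (measurableT_comp (measurable_rV_coord i) mf). Qed.

Lemma measurable_rVB (R : realType) n d (T : measurableType d)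
    (f g : T -> 'rV[R]_n) :
  measurable_fun [set: T] f -> measurable_fun [set: T] g ->
  measurable_fun [set: T] (fun t => f t - g t).
Proof.
move=> mf mg; apply: measurable_fun_rV => i.
rewrite (_ : _ \o _ = (fun t => f t ord0 i : R) \- (fun t => g t ord0 i)).
  by apply: measurable_funB; exact: measurable_coord.
by apply/funext => t; rewrite /rV_coord /= !mxE.
Qed.

Lemma measurable_dotv (R : realType) n d (T : measurableType d)
    (f g : T -> 'rV[R]_n) :
  measurable_fun [set: T] f -> measurable_fun [set: T] g ->
  measurable_fun [set: T] (fun t => dotv (f t) (g t)).
Proof.
move=> mf mg; apply: measurable_sum => i.
by apply: measurable_funM; exact: measurable_coord.
Qed.

Lemma measurable_enorm (R : realType) n d (T : measurableType d)
    (f : T -> 'rV[R]_n) :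
  measurable_fun [set: T] f -> measurable_fun [set: T] (fun t => enorm (f t)).
Proof.
move=> mf; apply: (@measurableT_comp _ _ _ _ _ _ (@Num.sqrt R)).
  by apply: continuous_measurable_fun; exact: sqrt_continuous.
exact: measurable_dotv.
Qed.

(** A sup-norm ball is a product of intervals, so [rV_cons] turns it into an interval times a ball
    of one dimension less, and each dimension contributes a factor 2r. *)
Lemma lebesgue_rV_sup_ball (R : realType) n (x : 'rV[R]_n) (r : R) : 0 <= r ->
  (lebesgue_rV R n [set y : 'rV[R]_n | (`|y - x| <= r)%R] <= (2 ^+ n * r ^+ n)%:E)%E.
Proof.
move=> r0; elim: n x => [|n IH] x.
  rewrite /= diracE !expr0 mulr1 lee_fin.
  by case: (_ \in _); rewrite ?lexx ?ler01.
rewrite /= /lebesgue_rV_step /pushforward.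
rewrite (_ : _ @^-1` _ = `[x ord0 ord0 - r, x ord0 ord0 + r] `*`
    [set y : 'rV[R]_n | `|y - \row_j x ord0 (lift ord0 j)| <= r]).
  rewrite product_measure1E//; last exact: measurable_sup_ball.
  rewrite [X in (X * _)%E](_ : _ = (2 * r)%:E); last first.
    (* The second case is the degenerate interval, r = 0. *)
    rewrite /= lebesgue_measure_itv/= lte_fin; case: ltP => rx.
      by rewrite -EFinB; congr EFin; ring.
    by congr EFin; lra.
  rewrite !exprS mulrACA [leRHS]EFinM; apply: lee_wpmul2l.
    by rewrite lee_fin mulr_ge0.
  exact: IH.
apply/seteqP; split => -[a y] /=.
  move=> /(rV_normP _ r0) H; split.
    by have := H ord0; rewrite !mxE unlift_none in_itv/= -ler_distl.
  by apply/rV_normP => // j; have := H (lift ord0 j); rewrite !mxE liftK.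
rewrite in_itv/= -ler_distl; move=> [H1 /(rV_normP _ r0) H2]; apply/rV_normP => // j.
case: (unliftP ord0 j) => [i|] ->.
  by have := H2 i; rewrite !mxE liftK.
by rewrite !mxE unlift_none.
Qed.

(** * Integrals of functions with one power near zero and another at infinity *)

(** The terms are nonnegative, so integral and series can be exchanged; what remains is dominated by
    a geometric series. *)
Lemma integral_indic_geometric (R : realType) d (T : measurableType d)
    (mu : {measure set T -> \bar R}) (E : (set T)^nat) (u : R^nat) (A q : R) :
  (forall k, measurable (E k)) -> (forall k, 0 <= u k) ->
  0 <= A -> 0 <= q < 1 ->
  (forall k, ((u k)%:E * mu (E k) <= (A * q ^+ k)%:E)%E) ->
  (\int[mu]_x \big[+%E/0%E]_(0 <= k <oo) (u k * \1_(E k) x)%:E <=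
   (A / (1 - q))%:E)%E.
Proof.
move=> mE u0 A0 /andP[q0 q1] uE.
rewrite integral_nneseries//; last first.
- by move=> k x _; rewrite lee_fin mulr_ge0.
- move=> k; apply/measurable_EFinP; apply: measurable_funM => //.
apply: (@le_trans _ _ (\big[+%E/0%E]_(0 <= k <oo) (geometric A q k)%:E)).
  apply: lee_nneseries => [k _ _|k _].
    by apply: integral_ge0 => x _; rewrite lee_fin mulr_ge0.
  rewrite (@integralZl_indic _ _ _ _ _ measurableT (fun _ => E k))//.
    by rewrite integral_indic// setIT uE.
  by rewrite ltNge u0.
have qq : `|q| < 1 by rewrite ger0_norm.
have /cvg_lim := @cvg_geometric_series _ A q qq.
move=> <-//; rewrite -EFin_lim; last exact: is_cvg_geometric_series.
rewrite le_eqVlt; apply/orP; left; apply/eqP.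
by congr (limn _); apply/funext => n /=; rewrite sumEFin.
Qed.

Lemma powR2_lt1 (R : realType) (x : R) : x < 0 -> 2 `^ x < 1.
Proof.
move=> x0; rewrite -[x]opprK powRN invf_lt1 ?powR_gt0//.
rewrite -[ltLHS](_ : 1 `^ (- x) = 1); last by rewrite powR1.
by apply: gt0_ltr_powR; rewrite ?nnegrE ?oppr_gt0//; lra.
Qed.

Lemma powRXn (R : realType) (x a : R) k : 0 <= x ->
  (x ^+ k) `^ a = (x `^ a) ^+ k.
Proof.
move=> x0; rewrite -powR_mulrn// -powRrM mulrC powRrM powR_mulrn//.
exact: powR_ge0.
Qed.

(* At r = 0 the value is 0, since x `^ (- a) is 0 at x = 0 when a != 0. *)
Definition two_power (R : realType) (a b r : R) : R :=
  if r <= 1 then r `^ (- a) else r `^ (- b).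

Lemma two_power_ge0 (R : realType) (a b r : R) : 0 <= two_power a b r.
Proof. by rewrite /two_power; case: ifP => _; exact: powR_ge0. Qed.

Lemma measurable_two_power (R : realType) (a b : R) d (T : measurableType d)
    (f : T -> R) : measurable_fun [set: T] f ->
  measurable_fun [set: T] (fun x => two_power a b (f x)).
Proof.
move=> mf; apply: measurable_fun_ifT.
- by apply: measurable_fun_ler.
- by apply: (@measurableT_comp _ _ _ _ _ _ (@powR R ^~ (- a)) _ f) => //;
    exact: measurable_powR.
- by apply: (@measurableT_comp _ _ _ _ _ _ (@powR R ^~ (- b)) _ f) => //;
    exact: measurable_powR.
Qed.

(** Take the least [k] satisfying the left inequality; minimality gives the right one, except for k
    = 0, where it is r <= 1. *)
Lemma dyadic_small (R : realType) (r : R) : 0 < r -> r <= 1 ->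
  exists k : nat, 2^-1 ^+ k.+1 <= r <= 2^-1 ^+ k.
Proof.
move=> r0 r1.
have ex : exists k, (2^-1 : R) ^+ k.+1 <= r.
  have : (2^-1 : R) ^+ n @[n --> \oo] --> 0 by apply: cvg_expr; rewrite ger0_norm; lra.
  move/(cvgr_lt 0)/(_ _ r0) => [k _ /(_ k.+1 (leqnSn k)) /ltW kr].
  by exists k.
have [[|m] mr mP] := ex_minnP ex; first by exists 0; rewrite mr expr0 r1.
exists m.+1; rewrite mr /= leNgt; apply/negP => /ltW /mP; by rewrite ltnn.
Qed.

Lemma dyadic_large (R : realType) (r : R) : 1 <= r ->
  exists k : nat, 2 ^+ k <= r <= 2 ^+ k.+1.
Proof.
move=> r1; have ri : 0 < r^-1 by rewrite invr_gt0; lra.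
have [|k /andP[rk kr]] := dyadic_small ri.
  by rewrite invf_le1//; lra.
exists k; move: rk kr; rewrite !exprVn => rk kr.
have r0 : 0 < r by lra.
have p (j : nat) : 0 < 2 ^+ j :> R by rewrite exprn_gt0.
by apply/andP; split; [rewrite -lef_pV2// posrE|rewrite -lef_pV2//posrE].
Qed.

(** The sum of two geometric series. The ball {rho <= 2^-k} with weight 2^(a(k+1)) contributes C 2^a
    (2^(a-N))^k; the ball {rho <= 2^(k+1)} with weight 2^(-bk) contributes C 2^N (2^(N-b))^k. Both
    ratios are below 1 when a < N < b. *)
Definition two_power_bound (R : realType) (C : R) (N : nat) (a b : R) : R :=
  C * 2 `^ a / (1 - 2 `^ (a - N%:R)) + C * 2 ^+ N / (1 - 2 `^ (N%:R - b)).

Section two_power_integral.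
Variables (R : realType) (d : measure_display) (T : measurableType d).
Variables (mu : {measure set T -> \bar R}) (rho : T -> R).
Variables (C a b : R) (N : nat).
Hypothesis mrho : measurable_fun [set: T] rho.
Hypothesis rho0 : forall x, 0 <= rho x.
Hypothesis C0 : 0 <= C.
Hypothesis growth : forall r, 0 < r ->
  (mu [set x | (rho x <= r)%R] <= (C * r ^+ N)%:E)%E.
Hypotheses (a0 : 0 < a) (aN : a < N%:R) (Nb : N%:R < b).

Let E k := [set x | rho x <= 2^-1 ^+ k].
Let F k := [set x | rho x <= 2 ^+ k.+1].

Let mball r : measurable [set x | rho x <= r].
Proof.
rewrite (_ : [set _ | _] = rho @^-1` `]-oo, r]).
  by rewrite -[X in measurable X]setTI; exact: mrho.
by apply/seteqP; split => x /=; rewrite in_itv.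
Qed.

Let le_series (u : R^nat) (G : (set T)^nat) x k : (forall k, 0 <= u k) ->
  G k x -> ((u k)%:E <= \big[+%E/0%E]_(0 <= k <oo) (u k * \1_(G k) x)%:E)%E.
Proof.
move=> u0 Gx.
have v0 (n : nat) : (0 <= (u n * \1_(G n) x)%:E)%E.
  by rewrite lee_fin mulr_ge0.
apply: le_trans (nneseries_lim_ge k.+1 _); last by move=> *; exact: v0.
rewrite big_nat_recr//= indicE mem_set// mulr1 leeDr// sume_ge0// => *.
Qed.

(** A point with 2^-(k+1) <= rho <= 2^-k lies in [E k], and there rho^-a <= 2^(a(k+1)); for 2^k <=
    rho <= 2^(k+1) it lies in [F k], and rho^-b <= 2^(-bk). One term of one series therefore
    suffices. Balls may replace shells because all terms are nonnegative. *)
Let two_power_le x : ((two_power a b (rho x))%:E <=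
  \big[+%E/0%E]_(0 <= k <oo) ((2 `^ a) ^+ k.+1 * \1_(E k) x)%:E +
  \big[+%E/0%E]_(0 <= k <oo) ((2 `^ (- b)) ^+ k * \1_(F k) x)%:E)%E.
Proof.
have u0 k : 0 <= (2 `^ a) ^+ k.+1 by rewrite exprn_ge0// powR_ge0.
have v0 k : 0 <= (2 `^ (-b)) ^+ k by rewrite exprn_ge0// powR_ge0.
have U0 : (0 <= \big[+%E/0%E]_(0 <= k <oo) ((2 `^ a) ^+ k.+1 * \1_(E k) x)%:E)%E.
  by apply: nneseries_ge0 => k _ _; rewrite lee_fin mulr_ge0.
have V0 : (0 <= \big[+%E/0%E]_(0 <= k <oo) ((2 `^ (-b)) ^+ k * \1_(F k) x)%:E)%E.
  by apply: nneseries_ge0 => k _ _; rewrite lee_fin mulr_ge0.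
rewrite /two_power; case: ifPn => [r1|]; last rewrite -ltNge => r1.
  have [r0|/negbTE] := eqVneq (rho x) 0.
    by rewrite r0 powR0 ?adde_ge0// oppr_eq0 gt_eqF.
  have := rho0 x; rewrite le_eqVlt eq_sym => /orP[->//|r0 _].
  have [k /andP[kr rk]] := dyadic_small r0 r1.
  apply: le_trans (leeDl _ V0); apply: le_trans (le_series u0 rk).
  have p0 : 0 < (2^-1 : R) ^+ k.+1 by rewrite exprn_gt0// invr_gt0.
  rewrite lee_fin powRN -[leRHS]invrK lef_pV2 ?posrE ?powR_gt0
    ?invr_gt0 ?exprn_gt0 ?powR_gt0//.
  rewrite (_ : _^-1 = (2^-1 ^+ k.+1) `^ a); last first.
    rewrite powRXn//; have -> : 2^-1 `^ a = (2 `^ a)^-1 :> R.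
      by rewrite -powR_inv1// powRAC powR_inv1 ?powR_ge0.
    by rewrite exprVn.
  by apply: ge0_ler_powR => //; rewrite ?nnegrE ltW.
have [k /andP[kr rk]] := dyadic_large (ltW r1).
apply: le_trans (leeDr _ U0); apply: le_trans (le_series v0 rk).
have p0 : 0 < (2 : R) ^+ k by rewrite exprn_gt0.
have r0 : 0 < rho x by lra.
have b0 : 0 <= b by rewrite (le_trans _ (ltW Nb)).
rewrite lee_fin powRN powRN exprVn -powRXn// lef_pV2 ?posrE ?powR_gt0//.
by apply: ge0_ler_powR => //; rewrite ?nnegrE ltW.
Qed.

(* A measure with mu {rho <= r} <= C r^N needs no polar coordinates: compare
   with the step function that is constant on the dyadic shells of rho. *)
Lemma integral_two_power :
  (\int[mu]_x (two_power a b (rho x))%:E <= (two_power_bound C N a b)%:E)%E.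
Proof.
have u0 k : 0 <= (2 `^ a) ^+ k.+1 by rewrite exprn_ge0// powR_ge0.
have v0 k : 0 <= (2 `^ (-b)) ^+ k by rewrite exprn_ge0// powR_ge0.
have mE k : measurable (E k) by exact: mball.
have mF k : measurable (F k) by exact: mball.
have series_ge0 (u : R^nat) (G : (set T)^nat) (x : T) : (forall k, 0 <= u k) ->
    (0 <= \big[+%E/0%E]_(0 <= k <oo) (u k * \1_(G k) x)%:E)%E.
  by move=> uk; apply: nneseries_ge0 => k _ _; rewrite lee_fin mulr_ge0.
have mseries (u : R^nat) (G : (set T)^nat) : (forall k, 0 <= u k) ->
    (forall k, measurable (G k)) -> measurable_fun [set: T]
    (fun x => \big[+%E/0%E]_(0 <= k <oo) (u k * \1_(G k) x)%:E)%E.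
  move=> uk mG; apply: ge0_emeasurable_sum => [k x _ _|k _].
    by rewrite lee_fin mulr_ge0.
  by apply/measurable_EFinP; exact: measurable_funM.
apply: (@le_trans _ _ (\int[mu]_x
  (\big[+%E/0%E]_(0 <= k <oo) ((2 `^ a) ^+ k.+1 * \1_(E k) x)%:E +
  \big[+%E/0%E]_(0 <= k <oo) ((2 `^ (- b)) ^+ k * \1_(F k) x)%:E))%E).
  apply: ge0_le_integral => //.
  - by move=> x _; rewrite lee_fin two_power_ge0.
  - by apply/measurable_EFinP; exact: measurable_two_power.
  - by apply: emeasurable_funD; exact: mseries.
rewrite ge0_integralD//; [|by move=> *; exact: series_ge0|exact: mseries|
  by move=> *; exact: series_ge0|exact: mseries].
rewrite /two_power_bound EFinD.
apply: leeD; apply: integral_indic_geometric => //.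
- by rewrite mulr_ge0// powR_ge0.
- by rewrite powR_ge0 powR2_lt1// subr_lt0.
- move=> k; apply: le_trans (lee_wpmul2l _ (growth _)) _.
  + by rewrite lee_fin.
  + by rewrite exprn_gt0// invr_gt0.
  rewrite -EFinM lee_fin le_eqVlt; apply/orP; left; apply/eqP.
  rewrite exprS powRD; last by rewrite pnatr_eq0 implybT.
  rewrite powRN powR_mulrn// exprMn -exprM mulnC exprM !exprVn; ring.
- by rewrite mulr_ge0// exprn_ge0.
- by rewrite powR_ge0 powR2_lt1// subr_lt0.
- move=> k; apply: le_trans (lee_wpmul2l _ (growth _)) _.
  + by rewrite lee_fin.
  + by rewrite exprn_gt0.
  rewrite -EFinM lee_fin le_eqVlt; apply/orP; left; apply/eqP.
  rewrite powRD; last by rewrite pnatr_eq0 implybT.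
  rewrite powR_mulrn// exprMn -!exprM mulSn exprD (mulnC k); ring.
Qed.

End two_power_integral.

(** * Boundedness and Lipschitz continuity of test fields *)

Lemma compact_support_bounded (R : realType) n (W : normedModType R)
    (g : 'rV[R]_n -> W) (K : set 'rV[R]_n) :
  continuous g -> compact K -> (forall x, ~ K x -> g x = 0) ->
  exists2 M, 0 <= M & forall x, `|g x| <= M.
Proof.
move=> cg cK g0.
have /compact_bounded[M [_ Mg]] : compact (g @` K).
  by apply: continuous_compact => //; exact: continuous_subspaceT.
(* [compact_bounded] bounds the image by every number strictly above [M], and [M] may be
   negative. *)
exists (`|M| + 1) => [|x]; first by rewrite addr_ge0.
have [Kx|/g0 ->] := pselect (K x); last by rewrite normr0 addr_ge0.
apply: Mg; first by rewrite (le_lt_trans (ler_norm M))// ltrDl.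
by exists x.
Qed.

(** The complement of the closure is open, so [g] is zero on a neighbourhood of [x]. Partial
    derivatives of a test field thus vanish off the same compact set, which makes them bounded. *)
Lemma derive_off_support (R : realType) n (W : normedModType R)
    (g : 'rV[R]_n -> W) (v x : 'rV[R]_n) :
  ~ closure [set x | g x != 0] x -> 'D_v g x = 0.
Proof.
move=> ncx.
have ng : \forall y \near x, g y = 0.
  have : nbhs x (~` closure [set x | g x != 0]).
    by apply: open_nbhs_nbhs; split => //; exact/closed_openC/closed_closure.
  apply: filterS => y ny; apply/eqP; apply: contra_notT ny => gy.
  exact: subset_closure.
rewrite -(derive_cst (0 : W) x v).
by apply: near_eq_derive.
Qed.

(** The difference quotients on both sides coincide, which brings the one-variable mean value
    theorem to bear on each coordinate direction. *)
Lemma derive_line (R : realType) (V W : normedModType R) (g : V -> W)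
    (x v : V) (t : R) : derivable g (x + t *: v) v ->
  is_derive t 1 (fun s : R => g (x + s *: v)) ('D_v g (x + t *: v)).
Proof.
have E : (fun h : R => h^-1 *: (g (x + (h *: 1 + t) *: v) - g (x + t *: v))) =
    (fun h => h^-1 *: (g (h *: v + (x + t *: v)) - g (x + t *: v))).
  apply/funext => h; congr (_ *: (g _ - _)).
  by rewrite scalerDl addrCA [h *: 1]mulr1.
move=> dg; apply: DeriveDef.
  by rewrite /derivable /= E.
by rewrite /derive /= E.
Qed.

Lemma MVT_norm_le (R : realType) (f df : R -> R) (M s : R) :
  (forall t : R, is_derive t 1 f (df t)) -> (forall t, `|df t| <= M) ->
  `|f s - f 0| <= M * `|s|.
Proof.
move=> fdf dfM.
have cf : continuous f.
  by move=> t; apply/differentiable_continuous/derivable1_diffP.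
have [s0|s0] := leP 0 s.
  have [c _ ->] := MVT_segment s0 (fun x _ => fdf x) (continuous_subspaceT cf).
  by rewrite subr0 normrM ler_wpM2r.
have [c _] := MVT_segment (ltW s0) (fun x _ => fdf x) (continuous_subspaceT cf).
by rewrite distrC => ->; rewrite sub0r normrM normrN ler_wpM2r.
Qed.

(** The factor n counts the edges of an axis-parallel path from [x] to [y]; in the sup norm each
    edge is no longer than y - x. *)
Lemma coordinate_lipschitz (R : realType) n (g : 'rV[R]_n -> R) (M : R) :
  (forall i s (x : 'rV[R]_n), `|g (x + s *: delta_mx ord0 i) - g x| <= M * `|s|) ->
  0 <= M ->
  forall x y, `|g y - g x| <= n%:R * M * `|y - x|.
Proof.
move=> gM M0 x y.
(* [p] moves from x to y along the edges of a box, one coordinate at a time. *)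
pose p (k : nat) : 'rV[R]_n := \row_i if (i < k)%N then y ord0 i else x ord0 i.
have -> : g y - g x = \sum_(i < n) (g (p i.+1) - g (p i)).
  rewrite -(big_mkord xpredT (fun i => g (p i.+1) - g (p i))) telescope_sumr//.
  by congr (g _ - g _); apply/rowP => i; rewrite mxE ?ltn_ord.
apply: (le_trans (ler_norm_sum _ _ _)).
rewrite -mulrA mulr_natl -[X in _ *+ X]card_ord -sumr_const.
apply: ler_sum => i _.
have -> : p i.+1 = p i + (y ord0 i - x ord0 i) *: delta_mx ord0 i.
  apply/rowP => j; rewrite !mxE eqxx /= eq_sym -val_eqE /= ltnS.
  have [ij|ij|ij] := ltngtP i j; rewrite ?mulr0 ?addr0//.
  by rewrite mulr1 (val_inj ij) addrC subrK.
apply: (le_trans (gM _ _ _)); apply: ler_wpM2l => //.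
by have := coord_le_norm (y - x) i; rewrite !mxE.
Qed.

Lemma Cc_infty_continuous (R : realType) n (W : normedModType R) Omega
    (phi : 'rV[R]_n -> W) : Cc_infty Omega phi -> continuous phi.
Proof. by case=> /(_ 0%N). Qed.

Lemma Cc_infty_bounded (R : realType) n (W : normedModType R) Omega
    (phi : 'rV[R]_n -> W) : Cc_infty Omega phi ->
  exists2 M, 0 <= M & forall x, `|phi x| <= M.
Proof.
move=> [/(_ 0%N) /= cphi cK _]; apply: (compact_support_bounded cphi cK) => x nK.
by apply/eqP; apply: contra_notT nK => ?; exact: subset_closure.
Qed.

Lemma Cc_infty_lipschitz (R : realType) n m Omega
    (phi : 'rV[R]_n -> 'rV[R]_m) : Cc_infty Omega phi ->
  exists2 L, 0 <= L & forall x y, `|phi y - phi x| <= L * `|y - x|.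
Proof.
move=> [/(_ 1%N) /= [cphi dphi] cK _].
have /choice[M_ MP] : forall i : 'I_n, exists M, 0 <= M /\
    forall x, `|'D_(delta_mx ord0 i) phi x| <= M.
  move=> i; have [_ cD] := dphi i.
  have [M M0 MD] := compact_support_bounded cD cK
    (fun x => @derive_off_support _ _ _ phi (delta_mx ord0 i) x).
  by exists M.
(* Summing the bounds of the partial derivatives gives one bound valid for every direction. *)
pose M := \sum_i M_ i.
have M_M i : M_ i <= M.
  by rewrite /M (bigD1 i)//= lerDl sumr_ge0// => j _; have [] := MP j.
have M0 : 0 <= M by apply: sumr_ge0 => j _; have [] := MP j.
exists (n%:R * M); first by rewrite mulr_ge0.
move=> x y; apply/rV_normP => [|j]; first by rewrite !mulr_ge0.
rewrite !mxE; apply: (@coordinate_lipschitz _ _ (fun x => phi x ord0 j)) => // i s z.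
have [dphii _] := dphi i.
pose e : 'rV[R]_n := delta_mx ord0 i.
have dj w : derivable (fun x => phi x ord0 j) w e.
  by move/derivable_mxP : (dphii w); exact.
have := @MVT_norm_le R (fun s => phi (z + s *: e) ord0 j)
  (fun t => 'D_e (fun x => phi x ord0 j) (z + t *: e)) M s.
rewrite scale0r addr0; apply.
  by move=> t; exact: (@derive_line _ _ _ (fun x => phi x ord0 j)).
move=> t; apply: le_trans (M_M i); have [_ /(_ (z + t *: e))] := MP i.
apply: le_trans; rewrite derive_mx//.
by apply: le_trans (coord_le_norm _ j); rewrite mxE.
Qed.

(** * The Gamma function and continuity of [mu_frac] *)

Lemma ler_powR_le1 (R : realType) (r x y : R) : 0 < r -> r <= 1 -> x <= y ->
  r `^ y <= r `^ x.
Proof.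
move=> r0 r1 xy; rewrite /powR gt_eqF// ler_expR ler_wnM2r//.
exact: ln_le0.
Qed.

(** The growth hypothesis of [integrable_two_power] on the real line, with C = 2 and N = 1. *)
Lemma lebesgue_measure_sym_ball (R : realType) (r : R) : 0 < r ->
  (@lebesgue_measure R [set t | (`|t| <= r)%R] <= (2 * r ^+ 1)%:E)%E.
Proof.
move=> r0; rewrite (_ : [set t | _] = `[- r, r]%classic).
  rewrite lebesgue_measure_itv/= lte_fin gtrN// -EFinB lee_fin; lra.
by apply/seteqP; split => t /=; rewrite in_itv/= ler_norml.
Qed.

Lemma integrable_two_power (R : realType) d (T : measurableType d)
  (mu : {measure set T -> \bar R}) (rho : T -> R) (C a b : R) (N : nat) :
  measurable_fun [set: T] rho -> (forall x, 0 <= rho x) -> 0 <= C ->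
  (forall r, 0 < r -> (mu [set x | (rho x <= r)%R] <= (C * r ^+ N)%:E)%E) ->
  0 < a < N%:R -> N%:R < b ->
  mu.-integrable [set: T] (fun x => (two_power a b (rho x))%:E).
Proof.
move=> mrho rho0 C0 growth /andP[a0 aN] Nb; apply/integrableP; split.
  by apply/measurable_EFinP; exact: measurable_two_power.
under eq_integral do rewrite gee0_abs ?lee_fin ?two_power_ge0//.
apply: le_lt_trans (ltry (two_power_bound C N a b)).
exact: integral_two_power.
Qed.

(** After multiplication by t^2 e^t the left side is t^(s+1) <= t^(m+1). Raising t/(m+1) <=
    e^(t/(m+1)) to the power m+1 bounds this by (m+1)^(m+1) e^t. *)
Lemma powR_expRN_le (R : realType) (m : nat) (s t : R) : 1 <= t ->
  s + 1 <= m.+1%:R -> t `^ (s - 1) * expR (- t) <= m.+1%:R ^+ m.+1 * t `^ (- 2).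
Proof.
move=> t1 sm; have t0 : 0 < t by lra.
rewrite expRN ler_pdivrMr ?expR_gt0// mulrAC powRN ler_pdivlMr ?powR_gt0//.
rewrite -powRD; last by apply/implyP => _; rewrite gt_eqF.
apply: (@le_trans _ _ (t `^ m.+1%:R)); first by apply: ler_powR => //; lra.
rewrite powR_mulrn; last exact: ltW.
have -> : expR t = expR (t / m.+1%:R) ^+ m.+1.
  by rewrite -expRM_natl mulrC divfK.
rewrite -exprMn; apply: lerXn2r; rewrite ?nnegrE ?mulr_ge0 ?expR_ge0 ?(ltW t0)//.
by rewrite -ler_pdivrMl// mulrC; apply: le_trans (expR_ge1Dx _); rewrite lerDr.
Qed.

Section gamma.
Variable R : realType.
Implicit Types s t : R.

Let G s t := t `^ (s - 1) * expR (- t).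

Let measurable_G s D : measurable_fun D (G s).
Proof.
apply: measurable_funTS; apply: measurable_funM.
  exact: measurable_powR.
by apply: measurableT_comp => //; exact: measurable_expR.
Qed.

(** One integrable majorant for all [s] in a window around [s0]: a power above -1 controls the
    integrand near 0, and t^-2 controls it at infinity. *)
Let Gamma_bound s0 : 0 < s0 -> exists g : R -> R,
  (@lebesgue_measure R).-integrable `]0, +oo[ (EFin \o g) /\
  forall s, s0 / 2 < s < s0 + 1 -> forall t, 0 < t -> `|G s t| <= g t.
Proof.
move=> s00.
(* [dl] <= s0/2 < s makes t^(dl-1) dominate t^(s-1) on ]0, 1]; [dl] <= 1/2 keeps the exponent 1 - dl
   positive. *)
pose dl := Num.min (s0 / 2) 2^-1.
have dl0 : 0 < dl by rewrite lt_min; lra.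
have dl1 : dl <= 2^-1 by rewrite ge_min lexx orbT.
have dls : dl <= s0 / 2 by rewrite ge_min lexx.
(* Every s < s0 + 1 then satisfies s + 1 <= m + 1, as [powR_expRN_le] requires. *)
pose m := Num.truncn (s0 + 2).
have mP : s0 + 2 <= m.+1%:R by rewrite ltW// truncnS_gt.
pose K : R := m.+1%:R ^+ m.+1.
have K1 : 1 <= K by rewrite exprn_ege1// ler1n.
exists (fun t => K * two_power (1 - dl) 2 `|t|); split.
  apply: (@integrableS _ _ _ _ setT) => //.
  apply: (@integrableZl _ _ _ lebesgue_measure setT measurableT K
    (fun t => (two_power (1 - dl) 2 `|t|)%:E)).
  apply: (@integrable_two_power _ _ _ lebesgue_measure _ 2 _ _ 1) => //; last 2 first.
  - lra.
  - lra.
  exact: lebesgue_measure_sym_ball.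
move=> s /andP[s1 s2] t t0.
rewrite ger0_norm ?mulr_ge0 ?powR_ge0 ?expR_ge0//.
rewrite gtr0_norm// /two_power; case: ifPn => [t1|]; last first.
  rewrite -ltNge => t1; apply: powR_expRN_le; lra.
rewrite -[leLHS]mulr1 -[leRHS]mulrC; apply: ler_pM => //.
- by rewrite mulr_ge0// ?powR_ge0 ?expR_ge0.
- rewrite -[leRHS]mulr1; apply: ler_pM => //; rewrite ?powR_ge0 ?expR_ge0//.
    by apply: ler_powR_le1 => //; lra.
  by rewrite -expR0 ler_expR; lra.
Qed.

Let integrable_G s : 0 < s ->
  (@lebesgue_measure R).-integrable `]0, +oo[ (EFin \o G s).
Proof.
move=> s0; have [g [ig Gg]] := Gamma_bound s0.
apply: (le_integrable _ _ _ ig) => //.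
  by apply/measurable_EFinP; exact: measurable_G.
move=> t /=; rewrite in_itv/= andbT => t0.
rewrite lee_fin; apply: le_trans (ler_norm _); apply: Gg => //; lra.
Qed.

(** On [1, 2] the integrand is at least t^-1 e^-t >= e^-2 / 2, because s - 1 >= -1. Positivity
    allows division by Gamma in [mu_frac]. *)
Lemma Gamma_gt0 s : 0 < s -> 0 < Gamma s.
Proof.
move=> s0; have iG := integrable_G s0.
have GI : (\int[lebesgue_measure]_(t in `]0%R, +oo[) (G s t)%:E)%E \is a fin_num.
  exact: integrable_fin_num.
rewrite /Gamma /Rintegral -lte_fin fineK//.
have c0 : (0 < (2^-1 * expR (- 2) : R)%:E)%E.
  by rewrite lte_fin mulr_gt0 ?expR_gt0.
apply: (lt_le_trans c0).
apply: (@le_trans _ _ (\int[lebesgue_measure]_(t in `[1%R, 2%R]) (G s t)%:E)%E).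
  apply: (@le_trans _ _
    (\int[lebesgue_measure]_(t in `[1%R, 2%R]) (2^-1 * expR (- 2) : R)%:E)%E).
    rewrite integral_cst//= lebesgue_measure_itv/= lte_fin ltr1n -EFinB -EFinM lee_fin.
    lra.
  apply: ge0_le_integral => //.
    by apply/measurable_EFinP; exact: measurable_G.
  move=> t /=; rewrite in_itv/= => /andP[t1 t2]; rewrite lee_fin.
  apply: ler_pM; rewrite ?expR_ge0//; last by rewrite ler_expR; lra.
  apply: (@le_trans _ _ (t `^ (-1))); last by apply: ler_powR => //; lra.
  by rewrite powR_inv1 ?lef_pV2 ?posrE//; lra.
apply: ge0_subset_integral => //.
- by apply/measurable_EFinP; exact: measurable_G.
- by move=> t _; rewrite lee_fin mulr_ge0 ?powR_ge0 ?expR_ge0.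
- by move=> t /=; rewrite !in_itv/= andbT; lra.
Qed.

(** Continuity under the integral sign on ]s/2, s+1[, the window on which [Gamma_bound] supplies the
    majorant. *)
Lemma continuous_Gamma s : 0 < s -> {for s, continuous (@Gamma R)}.
Proof.
move=> s0; have [g [ig Gg]] := Gamma_bound s0.
apply: (@continuity_under_integral _ _ _ lebesgue_measure G `]0, +oo[ _
  (s / 2) (s + 1) _ _ g) => //.
- by move=> x /=; rewrite in_itv/= => /andP[sx _]; apply: integrable_G; lra.
- apply: aeW => t /=; rewrite in_itv/= andbT => t0 x _.
  apply: cvgM; last exact: cvg_cst.
  rewrite /powR gt_eqF//.
  apply: continuous_comp; last exact: continuous_expR.
  by apply: cvgM; [apply: cvgB; [exact: cvg_id|exact: cvg_cst]|exact: cvg_cst].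
- move=> x /=; rewrite in_itv/= => sx; apply: aeW => t /=.
  by rewrite in_itv/= andbT; exact: Gg.
- rewrite inE /= in_itv/=; lra.
Qed.

(** alpha < 1 keeps (1 - alpha)/2 positive, so the Gamma factor in the denominator is continuous and
    nonzero there. *)
Lemma continuous_mu_frac n (alpha : R) : 0 < alpha < 1 ->
  {for alpha, continuous (@mu_frac R n)}.
Proof.
move=> /andP[a0 a1].
apply: cvgM; last first.
  apply: cvgV; first by rewrite gt_eqF// Gamma_gt0//; lra.
  apply: (@cvg_comp _ _ _ (fun a => (1 - a) / 2) (@Gamma R)).
    apply: cvgM; last exact: cvg_cst.
    by apply: cvgB; [exact: cvg_cst|exact: cvg_id].
  apply: continuous_Gamma; lra.
apply: cvgM; last first.
  apply: (@cvg_comp _ _ _ (fun a => (n%:R + a + 1) / 2) (@Gamma R)).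
    apply: cvgM; last exact: cvg_cst.
    apply: cvgD; last exact: cvg_cst.
    by apply: cvgD; [exact: cvg_cst|exact: cvg_id].
  apply: continuous_Gamma; rewrite divr_gt0//.
  by rewrite ltr_wpDl// addr_ge0// ltW.
apply: cvgM; last exact: cvg_cst.
rewrite /powR pnatr_eq0/=.
apply: continuous_comp; last exact: continuous_expR.
by apply: cvgM; [exact: cvg_id|exact: cvg_cst].
Qed.

End gamma.

(** * The fractional divergence of a fixed test field *)

(** The Euclidean norm occurs in the denominator of the kernel; replacing it by the smaller sup norm
    only enlarges the bound, so all later estimates use sup-norm balls. *)
Lemma norm_le_enorm (R : realType) n (x : 'rV[R]_n) : `|x| <= enorm x.
Proof.
apply/rV_normP => [|i]; first exact: sqrtr_ge0.
rewrite -sqrtr_sqr ler_sqrt /dotv; last first.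
  by apply: sumr_ge0 => j _; rewrite -expr2 sqr_ge0.
rewrite (bigD1 i)//= expr2 lerDl.
by apply: sumr_ge0 => j _; rewrite -expr2 sqr_ge0.
Qed.

Lemma dotv_le (R : realType) n (x y : 'rV[R]_n) :
  `|dotv x y| <= n%:R * (`|x| * `|y|).
Proof.
apply: (le_trans (ler_norm_sum _ _ _)).
rewrite mulr_natl -[X in _ *+ X]card_ord -sumr_const.
apply: ler_sum => i _; rewrite normrM.
by apply: ler_pM => //; exact: coord_le_norm.
Qed.

Lemma powR_mull (R : realType) (r s : R) : 0 < r -> r * r `^ s = r `^ (s + 1).
Proof.
move=> r0; rewrite powRD; last by apply/implyP => _; rewrite gt_eqF.
by rewrite powRr1 ?ltW// mulrC.
Qed.

Definition fdiv_integrand (R : realType) n (beta : R)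
    (phi : 'rV[R]_n -> 'rV[R]_n) (x y : 'rV[R]_n) : R :=
  dotv (y - x) (phi y - phi x) / enorm (y - x) `^ (n%:R + beta + 1).

(** The numerator vanishes at y = x, so the estimates and limits below may assume |y - x| > 0. *)
Lemma fdiv_integrand_diag (R : realType) n (beta : R)
    (phi : 'rV[R]_n -> 'rV[R]_n) (x : 'rV[R]_n) : fdiv_integrand beta phi x x = 0.
Proof.
rewrite /fdiv_integrand /dotv big1 ?mul0r// => i _.
by rewrite subrr mxE mul0r.
Qed.

Section fdiv.
Variables (R : realType) (n : nat) (phi : 'rV[R]_n -> 'rV[R]_n) (a alpha : R).
Hypothesis n1 : (1 <= n)%N.
Hypothesis cphi : continuous phi.
Variables M L : R.
Hypotheses (M0 : 0 <= M) (L0 : 0 <= L).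
Hypothesis phiM : forall x, `|phi x| <= M.
Hypothesis phiL : forall x y, `|phi y - phi x| <= L * `|y - x|.
Hypotheses (a0 : 0 < a) (aalpha : a <= alpha) (alpha1 : alpha < 1).

Let mu := lebesgue_rV R n.
(** [L] serves near the diagonal and 2M, which bounds the oscillation of [phi], far from it; n comes
    from [dotv_le]. The exponents in [h] are the worst ones over [beta] in [a, alpha], namely alpha
    near and a far. *)
Let K := n%:R * (L + 2 * M).
Let h (r : R) := two_power (n%:R - 1 + alpha) (n%:R + a) r.

Let K0 : 0 <= K.
Proof. by rewrite /K; do 2 rewrite ?mulr_ge0 ?addr_ge0//. Qed.

(** With r = |y - x|, the numerator is at most n r |phi y - phi x|. For r <= 1 the Lipschitz bound
    leaves r^-(n-1+beta), largest at beta = alpha; for r > 1 the bound 2M leaves r^-(n+beta),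
    largest at beta = a. *)
Lemma fdiv_integrand_le beta x y : a <= beta <= alpha ->
  `|fdiv_integrand beta phi x y| <= K * h `|y - x|.
Proof.
move=> /andP[ab balpha].
have [->|xy] := eqVneq y x.
  by rewrite fdiv_integrand_diag normr0 mulr_ge0// two_power_ge0.
have r0 : 0 < `|y - x| by rewrite normr_gt0 subr_eq0.
have rE := norm_le_enorm (y - x).
set r := `|y - x| in r0 rE *.
have s0 : 0 <= n%:R + beta + 1.
  by rewrite !addr_ge0//; apply: le_trans ab; exact: ltW.
rewrite /fdiv_integrand normrM normfV [X in _ / X]ger0_norm ?powR_ge0//.
have E0 := lt_le_trans r0 rE.
apply: (@le_trans _ _ (n%:R * (r * `|phi y - phi x|) * r `^ (- (n%:R + beta + 1)))).
  apply: ler_pM => //; first by rewrite invr_ge0 powR_ge0.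
    exact: dotv_le.
  rewrite powRN lef_pV2 ?posrE ?powR_gt0//.
  by apply: ge0_ler_powR => //; rewrite nnegrE ltW.
have rN : r * r `^ (- (n%:R + beta + 1)) = r `^ (- (n%:R + beta)).
  by rewrite powR_mull// opprD subrK.
rewrite (_ : _ * _ = n%:R * (`|phi y - phi x| * r `^ (- (n%:R + beta)))); last first.
  by rewrite -rN; ring.
rewrite /K -mulrA; apply: ler_wpM2l => //.
rewrite /h /two_power; case: ifPn => [r1|]; last rewrite -ltNge => r1.
  apply: (@le_trans _ _ (L * r * r `^ (- (n%:R + beta)))).
    by apply: ler_wpM2r; rewrite ?powR_ge0 ?phiL.
  rewrite -mulrA; apply: ler_pM => //.
  - by rewrite mulr_ge0 ?powR_ge0 ?ltW.
  - by rewrite lerDl mulr_ge0.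
  by rewrite powR_mull//; apply: ler_powR_le1 => //; lra.
apply: ler_pM => //; rewrite ?powR_ge0//.
  apply: (le_trans (ler_normB _ _)).
  have := phiM x; have := phiM y; move: (L0); lra.
apply: ler_powR; [exact: ltW|lra].
Qed.

Let norm_growth (x : 'rV[R]_n) r : 0 < r ->
  (mu [set y : 'rV[R]_n | (`|y - x| <= r)%R] <= (2 ^+ n * r ^+ n)%:E)%E.
Proof. by move=> r0; apply: lebesgue_rV_sup_ball; exact: ltW. Qed.

Let mnorm (x : 'rV[R]_n) : measurable_fun [set: 'rV[R]_n] (fun y => `|y - x|).
Proof.
apply: (@measurableT_comp _ _ _ _ _ _ (fun x : 'rV[R]_n => `|x|)).
  exact: measurable_norm_rV.
exact: measurable_rVB.
Qed.

(** n >= 1 makes the near exponent positive, alpha < 1 puts it below n, and a > 0 puts the far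
    exponent above n. *)
Let exponents : 0 < n%:R - 1 + alpha < n%:R /\ n%:R < n%:R + a.
Proof.
have n1R : (1 : R) <= n%:R by rewrite ler1n.
have alpha0 := lt_le_trans a0 aalpha.
split; last by rewrite ltrDl.
by apply/andP; split; move: alpha1 alpha0 n1R; lra.
Qed.

Let integrable_h x : mu.-integrable setT (fun y => (K * h `|y - x|)%:E).
Proof.
have [E1 E2] := exponents.
apply: (@integrableZl _ _ _ mu setT measurableT K (fun y => (h `|y - x|)%:E)).
apply: (@integrable_two_power _ _ _ mu _ (2 ^+ n) _ _ n) => //.
by move=> r; exact: norm_growth.
Qed.

(** Independent of [x], since the volume bound for balls ignores the centre, and of [beta], since
    [h] does not contain it. *)
Let B := K * two_power_bound (2 ^+ n) n (n%:R - 1 + alpha) (n%:R + a).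

Let integral_h x : (\int[mu]_y (K * h `|y - x|)%:E <= B%:E)%E.
Proof.
have [/andP[E1 E2] E3] := exponents.
rewrite (@ge0_integralZl_EFin _ _ _ mu setT measurableT (fun y => (h `|y - x|)%:E)) //.
- rewrite /B [leRHS]EFinM; apply: lee_wpmul2l; first by rewrite lee_fin.
  by apply: integral_two_power => // r; exact: norm_growth.
- by move=> y _; rewrite lee_fin two_power_ge0.
- by apply/measurable_EFinP; exact: measurable_two_power.
Qed.

Lemma measurable_fdiv_integrand2 beta :
  measurable_fun [set: 'rV[R]_n * 'rV[R]_n]
    (fun p => fdiv_integrand beta phi p.1 p.2).
Proof.
have m21 : measurable_fun [set: 'rV[R]_n * 'rV[R]_n] (fun p => p.2 - p.1).
  exact: measurable_rVB.
have mphi := continuous_measurable_rV2 cphi.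
apply: measurable_funM.
  apply: measurable_dotv => //; apply: measurable_rVB.
    by apply: measurableT_comp => //.
  by apply: measurableT_comp => //.
rewrite (_ : (fun _ => _) = fun p : 'rV[R]_n * 'rV[R]_n =>
    enorm (p.2 - p.1) `^ (- (n%:R + beta + 1))).
  apply: (@measurableT_comp _ _ _ _ _ _ (@powR R ^~ (- (n%:R + beta + 1)))).
    exact: measurable_powR.
  exact: measurable_enorm.
by apply/funext => p; rewrite powRN.
Qed.

Lemma measurable_fdiv_integrand beta x :
  measurable_fun [set: 'rV[R]_n] (fdiv_integrand beta phi x).
Proof.
exact: (@measurableT_comp _ _ _ _ _ _ (fun p => fdiv_integrand beta phi p.1 p.2)
  _ (pair x) (measurable_fdiv_integrand2 beta)).
Qed.

(** The inner integral is the difference of the integrals of the positive and negative parts; each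
    is measurable in [x] by Tonelli, given joint measurability of the integrand. *)
Lemma measurable_fdiv beta : measurable_fun [set: 'rV[R]_n] (fdiv beta phi).
Proof.
apply: measurable_funM => //.
pose F p := (fdiv_integrand beta phi p.1 p.2)%:E.
have mF : measurable_fun [set: 'rV[R]_n * 'rV[R]_n] F.
  by apply/measurable_EFinP; exact: measurable_fdiv_integrand2.
apply: (@measurableT_comp _ _ _ _ _ _ (@fine R)) => //.
rewrite (_ : (fun _ => _) = fubini_F mu F^\+ \- fubini_F mu F^\-)%E.
  apply: emeasurable_funB; apply: measurable_fun_fubini_tonelli_F => //.
  - exact: measurable_funepos.
  - exact: measurable_funeneg.
apply/funext => x; rewrite integralE /=.
by congr (_ - _)%E; apply: eq_integral => y _; rewrite ?funeposE ?funenegE.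
Qed.

Lemma integrable_fdiv_integrand beta x : a <= beta <= alpha ->
  mu.-integrable setT (EFin \o fdiv_integrand beta phi x).
Proof.
move=> ab; apply: (le_integrable _ _ _ (integrable_h x)) => //.
  by apply/measurable_EFinP; exact: measurable_fdiv_integrand.
move=> y _ /=; rewrite lee_fin; apply: le_trans (ler_norm _).
exact: fdiv_integrand_le.
Qed.

Lemma fdiv_bounded beta x : a <= beta <= alpha ->
  `|fdiv beta phi x| <= `|mu_frac n beta| * B.
Proof.
move=> ab; rewrite normrM; apply: ler_wpM2l => //.
rewrite -lee_fin.
apply: le_trans (integral_h x).
rewrite EFin_normr_Rintegral//; last exact: integrable_fdiv_integrand.
apply: le_trans (le_abse_integral _ _ _) _ => //.
  by apply/measurable_EFinP; exact: measurable_fdiv_integrand.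
apply: ge0_le_integral => //.
- apply: measurableT_comp => //.
  by apply/measurable_EFinP; exact: measurable_fdiv_integrand.
- exact: (measurable_int _ (integrable_h x)).
- by move=> y _; rewrite lee_fin fdiv_integrand_le.
Qed.

(** The constant converges by continuity of [mu_frac], the integral by dominated convergence in [y]
    with majorant K h(|y - x|). *)
Lemma fdiv_cvg (u : R^nat) x : (forall k, a <= u k < alpha) ->
  u @ \oo --> alpha -> fdiv (u k) phi x @[k --> \oo] --> fdiv alpha phi x.
Proof.
move=> ua ualpha.
have ua' k : a <= u k <= alpha by have /andP[-> /ltW] := ua k.
apply: cvgM.
  apply: (@cvg_comp _ _ _ u (@mu_frac R n)) ualpha _.
  apply: continuous_mu_frac; apply/andP; split => //; exact: lt_le_trans aalpha.
apply: fine_cvg; rewrite fineK; last first.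
  apply: (integrable_fin_num _ (integrable_fdiv_integrand _ _)) => //.
  by rewrite aalpha lexx.
have [] := @dominated_convergence _ _ _ mu setT measurableT
  (fun k y => (fdiv_integrand (u k) phi x y)%:E)
  (fun y => (fdiv_integrand alpha phi x y)%:E)
  (fun y => (K * h `|y - x|)%:E); last by move=> _ _.
- by move=> k; apply/measurable_EFinP; exact: measurable_fdiv_integrand.
- by apply/measurable_EFinP; exact: measurable_fdiv_integrand.
- apply: aeW => y _; apply: cvg_EFin; first exact: nearW.
  have [->|xy] := eqVneq y x.
    rewrite fdiv_integrand_diag.
    under eq_fun do rewrite /= fdiv_integrand_diag.
    exact: cvg_cst.
  have E0 : 0 < enorm (y - x).
    by apply: lt_le_trans (norm_le_enorm _); rewrite normr_gt0 subr_eq0.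
  apply: cvgM; first exact: cvg_cst.
  apply: cvgV; first by rewrite gt_eqF// powR_gt0.
  (* For a positive base [powR] is exp(p ln x), which is continuous in the exponent. *)
  rewrite /powR gt_eqF//.
  apply: (@cvg_comp _ _ _
    (fun k => (n%:R + u k + 1) * ln (enorm (y - x))) expR); last first.
    exact: continuous_expR.
  apply: cvgM; last exact: cvg_cst.
  apply: cvgD; last exact: cvg_cst.
  by apply: cvgD; [exact: cvg_cst|exact: ualpha].
- exact: integrable_h.
- by apply: aeW => y k _ /=; rewrite lee_fin fdiv_integrand_le.
Qed.

(** In [fdiv_bounded] only the factor [mu_frac] varies with [k], and a convergent sequence is
    bounded. *)
Lemma fdiv_uniform_bound (u : R^nat) : (forall k, a <= u k < alpha) ->
  u @ \oo --> alpha ->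
  exists2 C, 0 <= C & forall k x, `|fdiv (u k) phi x| <= C.
Proof.
move=> ua ualpha.
have mualpha : mu_frac n (u k) @[k --> \oo] --> mu_frac n alpha.
  apply: (@cvg_comp _ _ _ u (@mu_frac R n)) ualpha _.
  apply: continuous_mu_frac; apply/andP; split => //; exact: lt_le_trans aalpha.
have [N [_ NP]] := cvg_seq_bounded (cvgP _ mualpha).
have N1 k : `|mu_frac n (u k)| <= `|N| + 1.
  by apply: NP => //; rewrite (le_lt_trans (ler_norm N))// ltrDl.
have B0 : 0 <= B.
  rewrite -lee_fin; apply: le_trans (integral_h 0).
  by apply: integral_ge0 => y _; rewrite lee_fin mulr_ge0// two_power_ge0.
exists ((`|N| + 1) * B); first by rewrite mulr_ge0// addr_ge0.
move=> k x; apply: le_trans (fdiv_bounded _ _) _.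
  by have /andP[-> /ltW] := ua k.
exact: ler_wpM2r.
Qed.

End fdiv.

(** * Lower limits, and left limits along sequences *)

(** The lower limit is a supremum, over sets of the filter, of infima of [h]. For each e > 0 the set
    where h >= l - e belongs to the filter and shows that this supremum is at least l - e. *)
Lemma le_limf_einf (R : realType) (T : choiceType) (X : filteredType T)
    (F : set_system X) (FF : Filter F) (g h : X -> \bar R) (l : R) :
  g x @[x --> F] --> l%:E -> (\forall x \near F, (g x <= h x)%E) ->
  (l%:E <= limf_einf h F)%E.
Proof.
move=> gl gh; rewrite limf_einfE; apply/lee_subgt0Pr => e e0.
move/fine_cvgP : gl => [gfin /cvgrPdist_lt/(_ _ e0) gle].
have V : \forall x \near F, (l%:E - e%:E <= h x)%E.
  near=> x; apply: (@le_trans _ _ (g x)); last by near: x.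
  rewrite -(@fineK _ (g x)); last by near: x.
  rewrite -EFinB lee_fin lerBlDr -lerBlDl.
  by apply: le_trans (ler_norm _) _; apply: ltW; near: x.
apply: (@le_trans _ _ (ereal_inf (h @` [set x | (l%:E - e%:E <= h x)%E]))).
  by apply: le_ereal_inf_tmp => _ [x hx <-].
by apply: ereal_sup_ubound; exists [set x | (l%:E - e%:E <= h x)%E].
Unshelve. all: by end_near. Qed.

(** Replacing [x] by max(x, a) changes nothing near [p] and forces every test sequence to stay above
    [a], the range in which the bounds on [fdiv] hold. *)
Lemma cvge_at_left_seq (R : realType) (F : R -> \bar R) (a p l : R) : a < p ->
  (forall u : R^nat, (forall k, a <= u k < p) -> u @ \oo --> p ->
    F (u k) @[k --> \oo] --> l%:E) ->
  F x @[x --> p^'-] --> l%:E.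
Proof.
move=> ap Fl.
have : F (Num.max x a) @[x --> p^'-] --> l%:E.
  apply/cvge_at_leftP => u [up ucvg].
  apply: (Fl (fun k => Num.max (u k) a)) => [k|].
    by rewrite le_max lexx orbT gt_max up.
  apply: cvg_trans (ucvg); apply: near_eq_cvg.
  near=> k; apply/esym/max_idPl; apply: ltW.
  by near: k; exact: (cvgr_gt p ucvg).
apply: cvg_trans; apply: near_eq_cvg.
near=> x; congr F; apply/max_idPl.
by near: x; apply: filterS (nbhs_left_gt ap) => x /ltW.
Unshelve. all: by end_near. Qed.

(** * Pairing L^1 convergence with bounded pointwise convergence *)

Section bounded_pairing.
Variables (R : realType) (d : measure_display) (T : measurableType d).
Variables (mu : {measure set T -> \bar R}).
Implicit Types g w : T -> R.

Lemma integrable_mul_bounded g w C : mu.-integrable setT (EFin \o g) ->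
  measurable_fun setT w -> (forall x, `|w x| <= C) ->
  mu.-integrable setT (fun x => (g x * w x)%:E).
Proof.
move=> ig mw wC.
have mg : measurable_fun setT g by apply/measurable_EFinP; exact: measurable_int ig.
apply: (@le_integrable _ _ _ mu setT measurableT _ (fun x => C%:E * (g x)%:E)%E).
- by apply/measurable_EFinP; exact: measurable_funM.
- move=> x _ /=; rewrite lee_fin !normrM mulrC ler_wpM2r//.
  by rewrite (le_trans (wC x))// ler_norm.
- exact: integrableZl.
Qed.

Lemma integral_mul_bounded_le g w C : mu.-integrable setT (EFin \o g) ->
  measurable_fun setT w -> (forall x, `|w x| <= C) -> 0 <= C ->
  (`|\int[mu]_x (g x * w x)%:E| <= C%:E * 'N[mu]_1[EFin \o g])%E.
Proof.
move=> ig mw wC C0.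
have mg : measurable_fun setT g by apply/measurable_EFinP; exact: measurable_int ig.
have mgw : measurable_fun setT (fun x => (g x * w x)%:E).
  by apply/measurable_EFinP; exact: measurable_funM.
have mng : measurable_fun setT (fun x => `|(EFin \o g) x|)%E.
  by apply: measurableT_comp => //; apply/measurable_EFinP.
apply: le_trans (le_abse_integral _ _ _) _ => //.
rewrite Lnorm1 -ge0_integralZl_EFin//.
apply: ge0_le_integral => //.
- exact: measurableT_comp.
- exact: measurable_funeM.
- by move=> x _ /=; rewrite lee_fin normrM mulrC ler_wpM2r.
Qed.

(** Split g_k w_k = (g_k - g) w_k + g w_k. The first integral is at most C times the L^1 norm of g_k
    - g; the second converges by dominated convergence with majorant C |g|. *)
Lemma integral_mul_cvg (g_ : nat -> T -> R) (w_ : nat -> T -> R) g w C :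
  (forall k, mu.-integrable setT (EFin \o g_ k)) ->
  mu.-integrable setT (EFin \o g) ->
  ('N[mu]_1[EFin \o (g_ k \- g)%R] @[k --> \oo] --> 0)%E ->
  (forall k, measurable_fun setT (w_ k)) -> measurable_fun setT w ->
  0 <= C -> (forall k x, `|w_ k x| <= C) ->
  (forall x, w_ k x @[k --> \oo] --> w x) ->
  (\int[mu]_x (g_ k x * w_ k x)%:E @[k --> \oo] -->
   \int[mu]_x (g x * w x)%:E)%E.
Proof.
move=> ig_ ig gcvg mw_ mw C0 w_C wcvg.
have mg : measurable_fun setT g by apply/measurable_EFinP; exact: measurable_int ig.
have cvg_fixed : (\int[mu]_x (g x * w_ k x)%:E @[k --> \oo] -->
    \int[mu]_x (g x * w x)%:E)%E.
  have [] := @dominated_convergence _ _ _ mu setT measurableT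
    (fun k x => (g x * w_ k x)%:E) (fun x => (g x * w x)%:E)
    (fun x => C%:E * `|(g x)%:E|)%E; last by move=> _ _.
  - by move=> k; apply/measurable_EFinP; exact: measurable_funM.
  - by apply/measurable_EFinP; exact: measurable_funM.
  - apply: aeW => x _; apply: cvg_EFin; first exact: nearW.
    by apply: cvgM; [exact: cvg_cst|exact: wcvg].
  - by apply: integrableZl => //; exact: integrable_abse.
  - by apply: aeW => x k _ /=; rewrite lee_fin normrM mulrC ler_wpM2r.
have igB k : mu.-integrable setT (EFin \o (g_ k \- g)).
  exact: (integrableB measurableT (ig_ k) ig).
have cvg_diff : (\int[mu]_x ((g_ k \- g) x * w_ k x)%:E @[k --> \oo] --> 0)%E.
  apply/cvg_abse0P; apply: (@squeeze_cvge _ _ _ _ (cst 0%E) _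
    (fun k => C%:E * 'N[mu]_1[EFin \o (g_ k \- g)%R])%E).
  - apply: nearW => k; rewrite abse_ge0 /=.
    exact: (integral_mul_bounded_le (igB k) (mw_ k) (w_C k) C0).
  - exact: cvg_cst.
  - by rewrite -(mule0 C%:E); apply: (cvgeZl (y := C%:E)).
rewrite -[X in _ --> X]add0e.
rewrite (_ : (fun k => _) = fun k => (\int[mu]_x ((g_ k \- g) x * w_ k x)%:E +
    \int[mu]_x (g x * w_ k x)%:E)%E).
  by apply: cvgeD => //; rewrite ?fin_num_adde_defr.
apply/funext => k; rewrite -integralD//.
- by apply: eq_integral => x _; rewrite -EFinD -mulrDl /= subrK.
- exact: (integrable_mul_bounded (igB k) (mw_ k) (w_C k)).
- exact: (integrable_mul_bounded ig (mw_ k) (w_C k)).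
Qed.

End bounded_pairing.

(** * Lower semicontinuity of the fractional variation *)

Theorem theorem5p5 (R : realType) (n : nat) (n_ge1 : (1 <= n)%N)
    (alpha : R) (alpha01 : 0 < alpha < 1)
    (Omega : set 'rV[R]_n) (openOmega : open Omega)
    (f_ : R -> 'rV[R]_n -> R) (f : 'rV[R]_n -> R)
    (f_L1 : forall beta : R, 0 < beta < alpha ->
       (lebesgue_rV R n).-integrable setT (EFin \o f_ beta))
    (fL1 : (lebesgue_rV R n).-integrable setT (EFin \o f))
    (f_cvg : ('N[lebesgue_rV R n]_1[EFin \o (f_ beta \- f)%R])%E
               @[beta --> alpha^'-] --> 0%E) :
  (frac_variation alpha f Omega <=
   limf_einf (fun beta => frac_variation beta (f_ beta) Omega) alpha^'-)%E.
Proof.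
have /andP[alpha0 alpha1] := alpha01.
apply: ub_ereal_sup => _ [phi [Cphi phi1] <-].
have cphi := Cc_infty_continuous Cphi.
have [M M0 phiM] := Cc_infty_bounded Cphi.
have [L L0 phiL] := Cc_infty_lipschitz Cphi.
(* A positive lower bound for [beta] keeps the decay exponent n + beta of the kernel away from n. *)
pose a := alpha / 2.
have a0 : 0 < a by rewrite divr_gt0.
have aalpha : a < alpha by rewrite /a; lra.
pose H beta := (\int[lebesgue_rV R n]_x (f_ beta x * fdiv beta phi x)%:E)%E.
(* [le_limf_einf] takes a real limit, so the integral at [alpha] is first shown finite. *)
have fin : (\int[lebesgue_rV R n]_x (f x * fdiv alpha phi x)%:E)%E \is a fin_num.
  apply: integrable_fin_num => //; apply: integrable_mul_bounded => //.
    exact: measurable_fdiv.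
  move=> x; apply: (fdiv_bounded n_ge1 cphi M0 L0 phiM phiL a0 (ltW aalpha) alpha1).
  by rewrite lexx ltW.
rewrite -(fineK fin); apply: (@le_limf_einf _ _ _ _ _ H); last first.
  (* The class of test fields does not depend on [beta], so [phi] competes in every variation. *)
  by apply: nearW => beta; apply: ereal_sup_ubound; exists phi.
apply: (cvge_at_left_seq aalpha) => u ua ualpha; rewrite fineK//.
have [C C0 fC] := fdiv_uniform_bound n_ge1 cphi M0 L0 phiM phiL a0 (ltW aalpha)
  alpha1 ua ualpha.
apply: (integral_mul_cvg _ fL1 _ _ _ C0 fC).
- move=> k; apply: f_L1; have /andP[au ->] := ua k.
  by rewrite (lt_le_trans a0 au).
- apply: (@cvg_comp _ _ _ u
    (fun beta => 'N[lebesgue_rV R n]_1[EFin \o (f_ beta \- f)%R])%E) f_cvg.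
  (* Since u k < alpha, convergence of [u] to [alpha] is convergence along [alpha^'-]. *)
  by move=> A /ualpha; apply: (@filterS _ \oo) => k; apply; have /andP[] := ua k.
- by move=> k; exact: measurable_fdiv.
- exact: measurable_fdiv.
- move=> x; exact: (fdiv_cvg n_ge1 cphi M0 L0 phiM phiL a0 (ltW aalpha) alpha1 ua ualpha).
Qed.
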